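(* Let $K$ be a field, let $r\ge 2$ be an integer, and let $L_r$ be the line graph with edge ideal $I(L_r)=(x_1x_2,\,x_2x_3,\dots,x_{r-1}x_r)$ in $R=K[x_1,\dots,x_r]$. Then $\mathrm{pd}\,I(L_r)=\mathrm{ara}\,I(L_r)$, and this number is equal to $2s$ if $r=3s$ or $r=3s+1$ for some integer $s$, and to $2s+1$ if $r=3s+2$ for some integer $s$. Moreover, the equality $\mathrm{ara}\,I(L_r)=\mu(I(L_r))-\rho(I(L_r))+1$ holds if and only if $2\le r\le 6$; in all other cases $\mathrm{ara}\,I(L_r)<\mu(I(L_r))-\rho(I(L_r))+1$.
   Context: The line graph $L_r$ is the graph on the vertex set $\{x_1,\dots,x_r\}$ with edges $\{x_i,x_{i+1}\}$ for $i=1,\dots,r-1$. For an ideal $I$ of $R$, the arithmetical rank $\mathrm{ara}\,I$ is the least number of elements of $R$ which generate $I$ up to radical, and $\mathrm{pd}\,I$ denotes, by convention, the length of every minimal free resolution of the quotient $R/I$ over $R$. For the edge ideal $I=I(G)$ of a graph $G$ with at least one edge, $\mu(I)$ is the number of minimal monomial generators of $I$ (the number of edges of $G$), and $\rho(I)=\max_{\alpha}\min\{\deg(v): v\in\alpha\}$, where $\alpha$ ranges over the edges of $G$. *)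

(* Defs.v *)
From HB Require Import structures.
From mathcomp Require Import all_boot all_order all_algebra.
From mathcomp Require Import mpoly.

Set Implicit Arguments.
Unset Strict Implicit.
Unset Printing Implicit Defensive.

Import GRing.Theory.

Local Open Scope ring_scope.

Section Ideals.

Variable R : comNzRingType.

Definition ideal_gen (S : R -> Prop) (f : R) : Prop :=
  exists (n : nat) (c g : 'I_n -> R),
    (forall i, S (g i)) /\ f = \sum_(i < n) c i * g i.

Definition radical (I : R -> Prop) (f : R) : Prop := exists k : nat, I (f ^+ k).

Definition generates_up_to_radical (s : seq R) (I : R -> Prop) : Prop :=
  forall f : R, radical (ideal_gen (fun g => g \in s)) f <-> radical I f.

Definition is_ara (I : R -> Prop) (n : nat) : Prop :=
  (exists2 s : seq R, size s = n & generates_up_to_radical s I) /\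
  (forall s : seq R, generates_up_to_radical s I -> (n <= size s)%N).

End Ideals.

Section Resolutions.

Variables (K : fieldType) (r : nat).

Local Notation R := {mpoly K[r]}.

(* The data of a sequence ... -> F_2 -> F_1 -> F_0 -> R/I -> 0 of graded free
   modules F_i = \bigoplus_k R(- shift i k), of rank [rk i]. Elements of F_i are
   row vectors and maps act by right multiplication. The map F_0 -> R/I is
   represented by a lift to R of the images of the basis vectors. *)
Record free_seq := FreeSeq {
  rk : nat -> nat;
  shift : forall i, 'I_(rk i) -> int;
  aug : 'cV[R]_(rk 0);
  diff : forall i, 'M[R]_(rk i.+1, rk i)
}.

(* Integer degrees, so that a nonzero polynomial is never homogeneous of
   negative degree; 0 is homogeneous of every degree. *)
Definition homog_of_degree (d : int) (f : R) : Prop :=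
  forall m : 'X_{1..r}, m \in msupp f -> (mdeg m)%:Z = d.

Definition graded_seq (F : free_seq) : Prop :=
  (forall k, homog_of_degree (shift k) (aug F k 0)) /\
  (forall i k j, homog_of_degree (shift k - shift j) (diff F i k j)).

Definition exact_seq (I : R -> Prop) (F : free_seq) : Prop :=
  [/\ forall f : R, exists v : 'rV[R]_(rk F 0), I (f - (v *m aug F) 0 0),
      forall v : 'rV[R]_(rk F 0),
        I ((v *m aug F) 0 0) <-> exists w, v = w *m diff F 0
    & forall i (v : 'rV[R]_(rk F i.+1)),
        v *m diff F i = 0 <-> exists w, v = w *m diff F i.+1].

Definition irrelevant_ideal : R -> Prop :=
  ideal_gen (fun g : R => exists i : 'I_r, g = 'X_i).

Definition minimal_seq (F : free_seq) : Prop :=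
  forall i k j, irrelevant_ideal (diff F i k j).

Definition minimal_free_resolution (I : R -> Prop) (F : free_seq) : Prop :=
  [/\ graded_seq F, exact_seq I F & minimal_seq F].

Definition has_length (F : free_seq) (p : nat) : Prop :=
  (0 < rk F p)%N /\ (forall i, (p < i)%N -> rk F i = 0%N).

(* This is the projective dimension of the quotient R/I, not of the R-module I. *)
Definition is_pd (I : R -> Prop) (p : nat) : Prop :=
  (exists F, minimal_free_resolution I F) /\
  (forall F, minimal_free_resolution I F -> has_length F p).

(* For a monomial ideal I, the exponents of its minimal monomial generators:
   the monomials of I that are minimal for divisibility. *)
Definition minimal_monomial_generator (I : R -> Prop) (u : 'X_{1..r}) : Prop :=
  I 'X_[u] /\ (forall v : 'X_{1..r}, (v <= u)%MM -> I 'X_[v] -> v = u).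

Definition is_mu (I : R -> Prop) (n : nat) : Prop :=
  exists s : seq 'X_{1..r},
    [/\ uniq s, size s = n
      & forall u, u \in s <-> minimal_monomial_generator I u].

End Resolutions.

Section Graphs.

Record sgraph (r : nat) := SGraph {
  adj : rel 'I_r;
  adj_sym : ssrbool.symmetric adj;
  adj_irrefl : irreflexive adj
}.

Definition deg (r : nat) (G : sgraph r) (v : 'I_r) : nat := #|[set w | adj G v w]|.

Definition edge_ideal (K : fieldType) (r : nat) (G : sgraph r) :
    {mpoly K[r]} -> Prop :=
  ideal_gen (fun g : {mpoly K[r]} => exists i j, adj G i j /\ g = 'X_i * 'X_j).

(* The maximum runs over ordered pairs of adjacent vertices, so each edge occurs
   twice. *)
Definition rho (r : nat) (G : sgraph r) : nat :=
  \max_(e : 'I_r * 'I_r | adj G e.1 e.2) minn (deg G e.1) (deg G e.2).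

Definition line_adj (r : nat) : rel 'I_r :=
  fun i j => (i.+1 == j :> nat) || (j.+1 == i :> nat).

Lemma line_adj_sym (r : nat) : ssrbool.symmetric (@line_adj r).
Proof. by move=> i j; rewrite /line_adj orbC. Qed.

Lemma line_adj_irrefl (r : nat) : irreflexive (@line_adj r).
Proof. by move=> i; rewrite /line_adj orbb gtn_eqF. Qed.

Definition line_graph (r : nat) : sgraph r :=
  SGraph (@line_adj_sym r) (@line_adj_irrefl r).

End Graphs.

(* Main.v *)
Require Import Defs.
From mathcomp Require Import all_boot all_order all_algebra.
From mathcomp Require Import mpoly zify ring.
From Stdlib Require Import ClassicalEpsilon.

(** The common value of the projective dimension and the arithmetical rank of
    the path ideal is r - ceil(r/3), the largest size of a minimal vertex cover.

    For the projective dimension, appending a leaf b to a path that ends in a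
    adjoins x_a x_b to its ideal J. The mapping cone of a lift of multiplication
    by x_a x_b is a resolution of the longer path ideal. The lift is divisible by
    the new variable x_b, so the cone is again minimal ([cone_resolvable]). The
    colon ideal is that of a shorter path plus one variable, and an induction
    gives a minimal graded resolution of length r - ceil(r/3)
    ([resolvable_path]). Any two minimal resolutions have the same ranks, because
    comparison maps between them become mutually inverse at the origin
    ([minimal_resolution_rk_le]).

    The arithmetical rank is at least the height of each minimal prime. For the
    prime of a minimal vertex cover of size h, the other variables are set to 1
    ([minimal_cover_le_generators]). This leaves polynomials in h variables that
    generate the irrelevant ideal up to radical, and a dimension count shows that
    there are at least h of them ([primary_to_irrelevant_size]). Conversely, three
    consecutive edges a b, b c, c d are generated up to radical by the two
    elements b c and a b + c d, because (a b)(c d) is a multiple of b c; blocks of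
    three edges then give r - ceil(r/3) elements ([path_radical_gensP]).

    There are r - 1 minimal generators, and rho is 1 for r <= 3 and 2 otherwise,
    so the comparison with mu - rho + 1 is arithmetic. *)

Set Implicit Arguments.
Unset Strict Implicit.
Unset Printing Implicit Defensive.

Import GRing.Theory.

Local Open Scope ring_scope.

(** * Ideals given by generators *)

Section IdealClosure.

Variable R : comNzRingType.
Implicit Types (S : R -> Prop) (f g : R).

Lemma ideal_gen_base S g : S g -> ideal_gen S g.
Proof.
by move=> Sg; exists 1%N, (fun=> 1), (fun=> g); split=> //; rewrite big_ord1 mul1r.
Qed.

Lemma ideal_gen0 S : ideal_gen S 0.
Proof. by exists 0%N, (fun=> 0), (fun=> 0); split=> [[]|] //; rewrite big_ord0. Qed.

Lemma ideal_genD S f g : ideal_gen S f -> ideal_gen S g -> ideal_gen S (f + g).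
Proof.
case=> n [c [u [Su ->]]] [m [d [v [Sv ->]]]]; exists (n + m)%N.
exists (fun i => match split i with inl j => c j | inr j => d j end).
exists (fun i => match split i with inl j => u j | inr j => v j end).
split=> [i|]; first by case: (split i).
rewrite big_split_ord /=; congr (_ + _); apply: eq_bigr => i _.
  by have /= -> := unsplitK (inl i : 'I_n + 'I_m).
by have /= -> := unsplitK (inr i : 'I_n + 'I_m).
Qed.

Lemma ideal_genMl S f g : ideal_gen S g -> ideal_gen S (f * g).
Proof.
case=> n [c [u [Su ->]]]; exists n, (fun i => f * c i), u; split=> //.
by rewrite mulr_sumr; apply: eq_bigr => i _; rewrite mulrA.
Qed.

Lemma ideal_genMr S f g : ideal_gen S f -> ideal_gen S (f * g).
Proof. by rewrite mulrC; apply: ideal_genMl. Qed.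

Lemma ideal_genB S f g : ideal_gen S f -> ideal_gen S g -> ideal_gen S (f - g).
Proof. by move=> Sf Sg; rewrite -mulN1r; apply: ideal_genD => //; apply: ideal_genMl. Qed.

Lemma ideal_gen_sum S (T : eqType) (s : seq T) (F : T -> R) :
  (forall t, t \in s -> ideal_gen S (F t)) -> ideal_gen S (\sum_(t <- s) F t).
Proof.
move=> SF; rewrite big_seq; apply: big_ind => //; first exact: ideal_gen0.
by move=> f g; apply: ideal_genD.
Qed.

End IdealClosure.

Lemma dependent_choice_seq (T : nat -> Type) (P : forall i, T i -> Prop)
    (Q : forall i, T i -> T i.+1 -> Prop) (t0 : T 0%N) :
  P 0%N t0 -> (forall i t, P i t -> exists t', P i.+1 t' /\ Q i t t') ->
  exists f : forall i, T i, f 0%N = t0 /\ forall i, Q i (f i) (f i.+1).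
Proof.
move=> Pt0 step.
pose next i (u : {t | P i t}) : {t' | P i.+1 t'} :=
  let w := constructive_indefinite_description _ (step i (sval u) (svalP u)) in
  exist _ (sval w) (proj1 (svalP w)).
pose fix F i : {t | P i t} :=
  match i with 0 => exist _ t0 Pt0 | j.+1 => next j (F j) end.
exists (fun i => sval (F i)); split=> // i /=.
by case: (constructive_indefinite_description _ _) => t' [].
Qed.

(** * Homogeneous components *)

Section Homogeneous.

Variables (K : fieldType) (r : nat).
Local Notation R := {mpoly K[r]}.
Implicit Types (f g : R) (d e : int).

(** The homogeneous component of degree d; it vanishes when d is negative. *)
Definition hcomp d f : R :=
  \sum_(m <- msupp f | (mdeg m)%:Z == d) f@_m *: 'X_[m].

Lemma mcoeff_hcomp d f m :
  (hcomp d f)@_m = if (mdeg m)%:Z == d then f@_m else 0.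
Proof.
rewrite /hcomp raddf_sum /=.
under eq_bigr do rewrite mcoeffZ mcoeffX.
have [mf|mNf] := boolP (m \in msupp f); last first.
  rewrite big1_seq => [|k /andP[_ kf]].
    by move: mNf; rewrite -mcoeff_eq0 => /eqP ->; case: ifP.
  by have [km|] := eqVneq k m; rewrite ?mulr0 //; move: mNf; rewrite -km kf.
rewrite big_mkcond (bigD1_seq m) ?msupp_uniq //= eqxx mulr1.
rewrite big1 ?addr0 // => k /negbTE ->; rewrite mulr0; by case: ifP.
Qed.

Lemma homog_hcomp d f : homog_of_degree d (hcomp d f).
Proof.
by move=> m; rewrite mcoeff_msupp mcoeff_hcomp; case: ifP => [/eqP|_]; rewrite ?eqxx.
Qed.

Lemma homog0 d : homog_of_degree d (0 : R).
Proof. by move=> m; rewrite mcoeff_msupp mcoeff0 eqxx. Qed.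

Lemma homogN d f : homog_of_degree d f -> homog_of_degree d (- f).
Proof. by move=> hf m; rewrite mcoeff_msupp mcoeffN oppr_eq0 -mcoeff_msupp; apply: hf. Qed.

Lemma homogX (m : 'X_{1..r}) : homog_of_degree (mdeg m)%:Z ('X_[m] : R).
Proof. by move=> k; rewrite msuppX inE => /eqP ->. Qed.

Lemma homog1 : homog_of_degree 0 (1 : R).
Proof. by move=> k; rewrite msupp1 inE => /eqP ->; rewrite mdeg0. Qed.

Lemma homogM d e f g :
  homog_of_degree d f -> homog_of_degree e g -> homog_of_degree (d + e) (f * g).
Proof.
move=> hf hg m /msuppM_le /allpairsP[[m1 m2] /= [/hf <- /hg <- ->]].
by rewrite mdegD PoszD.
Qed.

Lemma hcomp_id d f : homog_of_degree d f -> hcomp d f = f.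
Proof.
move=> hf; apply/mpolyP => m; rewrite mcoeff_hcomp; case: ifP => // /eqP dm.
by apply/esym/eqP; rewrite mcoeff_eq0; apply/negP => /hf.
Qed.

Lemma hcomp_sum (I : Type) (s : seq I) (F : I -> R) d :
  hcomp d (\sum_(i <- s) F i) = \sum_(i <- s) hcomp d (F i).
Proof.
apply/mpolyP => m; rewrite mcoeff_hcomp !(raddf_sum (mcoeff m)) /=.
case: ifP => dm; last by rewrite big1 // => i _; rewrite mcoeff_hcomp dm.
by apply: eq_bigr => i _; rewrite mcoeff_hcomp dm.
Qed.

(** Multiplication by a homogeneous g only shifts degrees, so taking components
    commutes with it. This turns an arbitrary lift between graded resolutions
    into a graded one. *)
Lemma hcompM d e f g :
  homog_of_degree e g -> hcomp (d + e) (f * g) = hcomp d f * g.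
Proof.
move=> hg; apply/mpolyP => m; rewrite mcoeff_hcomp !mcoeffM.
case: eqP => [dm|dm].
  apply: eq_bigr => k /eqP mk; rewrite mcoeff_hcomp; case: eqP => // dk.
  have [->|] := eqVneq g@_(k.2) 0; first by rewrite !mulr0.
  rewrite -mcoeff_msupp => /hg ek; case: dk.
  by apply: (addIr e); rewrite -dm -ek -PoszD -mdegD; congr (Posz (mdeg _)).
apply/esym/big1 => k /eqP mk; rewrite mcoeff_hcomp; case: eqP => [dk|]; last by rewrite mul0r.
have [->|] := eqVneq g@_(k.2) 0; first by rewrite mulr0.
by rewrite -mcoeff_msupp => /hg ek; case: dm; rewrite -dk -ek -PoszD -mdegD; congr (Posz (mdeg _)).
Qed.

End Homogeneous.

(** * Comparison of resolutions and invariance of the ranks *)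

Section Resolutions.

Variables (K : fieldType) (r : nat).
Local Notation R := {mpoly K[r]}.
Local Notation "M @0" := (map_mx (mcoeff 0%MM) M) (at level 2, format "M @0").
Implicit Types (I J C : R -> Prop) (F G : free_seq K r).

Lemma irrelevant0 (f : R) : irrelevant_ideal f -> f@_0 = 0.
Proof.
case=> n [c [u [Xu ->]]]; rewrite raddf_sum /= big1 // => i _.
have [j ->] := Xu i.
by rewrite (rmorphM (mcoeff 0%MM)) /= mcoeffX mnm1_eq0 mulr0.
Qed.

Lemma irrelevant_var (i : 'I_r) : @irrelevant_ideal K r 'X_i.
Proof. by apply: ideal_gen_base; exists i. Qed.

Definition is_complex F := forall i, diff F i.+1 *m diff F i = 0.

Lemma exact_complex I F : exact_seq I F -> is_complex F.
Proof.
case=> _ _ ex i; apply/row_matrixP => k; rewrite row0 row_mul.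
by apply/ex; exists (delta_mx 0 k); rewrite rowE.
Qed.

Lemma submx_rows (m n p : nat) (A : 'M[R]_(m, n)) (B : 'M[R]_(p, n)) :
  (forall k, exists w, row k A = w *m B) -> exists W, A = W *m B.
Proof.
move=> AB; pose w k := sval (constructive_indefinite_description _ (AB k)).
exists (\matrix_k w k); apply/row_matrixP => k; rewrite row_mul rowK /w.
by case: (constructive_indefinite_description _ _).
Qed.

Lemma exact_kernel I F i (p : nat) (A : 'M[R]_(p, rk F i.+1)) :
  exact_seq I F -> A *m diff F i = 0 -> exists W, A = W *m diff F i.+1.
Proof.
case=> _ _ ex A0; apply: submx_rows => k.
by apply/ex; rewrite -row_mul A0 row0.
Qed.

Lemma exact_aug I F (p : nat) (A : 'M[R]_(p, rk F 0)) :
  exact_seq I F -> (forall k, I ((A *m aug F) k 0)) -> exists W, A = W *m diff F 0.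
Proof.
case=> _ ex _ IA; apply: submx_rows => k.
by apply/ex; rewrite -row_mul mxE.
Qed.

Lemma exact_diff0 I F k : exact_seq I F -> I ((diff F 0 *m aug F) k 0).
Proof.
case=> _ ex _; have := iffRL (ex (row k (diff F 0))).
by rewrite -row_mul mxE; apply; exists (delta_mx 0 k); rewrite rowE.
Qed.

Definition chain_map G F (theta : forall i, 'M[R]_(rk G i, rk F i)) :=
  forall i, theta i.+1 *m diff F i = diff G i *m theta i.

(** The comparison theorem: a map between the bottom modules that respects the
    augmentations extends to the whole resolution, since at each stage the next
    component only has to land in a kernel, which is an image by exactness. *)
Lemma chain_lift I F G (theta0 : 'M[R]_(rk G 0, rk F 0)) :
  exact_seq I F -> is_complex G ->
  (forall k, I ((diff G 0 *m theta0 *m aug F) k 0)) ->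
  exists theta : forall i, 'M[R]_(rk G i, rk F i),
    theta 0%N = theta0 /\ chain_map theta.
Proof.
move=> exF cG I0.
(* t can be continued by one step; this is what exactness propagates. *)
pose P i (t : 'M[R]_(rk G i, rk F i)) := exists t', t' *m diff F i = diff G i *m t.
pose Q i (t : 'M[R]_(rk G i, rk F i)) (t' : 'M[R]_(rk G i.+1, rk F i.+1)) :=
  t' *m diff F i = diff G i *m t.
apply: (@dependent_choice_seq _ P Q).
  by have [W W0] := exact_aug exF I0; exists W.
move=> i t [t' tt']; exists t'; split=> //.
have [|W W1] := exact_kernel (A := diff G i.+1 *m t') exF; last by exists W.
by rewrite -mulmxA tt' mulmxA cG mul0mx.
Qed.

Lemma minimal_diff0 F i : minimal_seq F -> (diff F i)@0 = 0.
Proof. by move=> mF; apply/matrixP => k j; rewrite !mxE irrelevant0. Qed.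

(** An endomorphism of a resolution lifting the identity is homotopic to it:
    chi - 1 = h d + d h'. All entries of the differentials of a minimal
    resolution vanish at the origin, hence so does chi - 1. *)
Lemma chain_endo_eval0 I F (chi : forall i, 'M[R]_(rk F i)) :
  exact_seq I F -> minimal_seq F -> chain_map chi ->
  (forall k, I (((chi 0%N - 1%:M) *m aug F) k 0)) ->
  forall i, (chi i)@0 = 1%:M.
Proof.
move=> exF mF chain I0 i.
(* h is the homotopy at level i, and E = d h' comes from the level below. *)
have [h [E [defchi _ E0]]] : exists (h : 'M_(rk F i, rk F i.+1)) (E : 'M_(rk F i)),
    [/\ chi i - 1%:M = h *m diff F i + E, diff F i *m E = 0 & E@0 = 0].
  elim: i => [|i [h [E [defchi dE _]]]].
    have [W W0] := exact_aug exF I0.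
    by exists W, 0; rewrite addr0 mulmx0 map_mx0.
  have [|W W0] := exact_kernel (A := chi i.+1 - 1%:M - diff F i *m h) exF.
    rewrite !mulmxBl mul1mx chain -mulmxA; have -> : h *m diff F i = chi i - 1%:M - E.
      by rewrite defchi addrK.
    by rewrite !mulmxBr dE mulmx1 subr0 subrr.
  exists W, (diff F i *m h); rewrite -W0 subrK map_mxM /= minimal_diff0 // mul0mx.
  by rewrite mulmxA (exact_complex exF) mul0mx.
apply/eqP; rewrite -subr_eq0; apply/eqP.
have -> : 1%:M = (1%:M : 'M[R]_(rk F i))@0 by rewrite map_mx1.
by rewrite -map_mxB defchi map_mxD map_mxM /= E0 minimal_diff0 // mulmx0 addr0.
Qed.

Lemma aug_lift I F G :
  I 0 -> exact_seq I F -> exists theta0 : 'M[R]_(rk G 0, rk F 0),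
    forall k, I ((aug G - theta0 *m aug F) k 0).
Proof.
move=> I0 [surj _ _].
pose w k := sval (constructive_indefinite_description _ (surj (aug G k 0))).
exists (\matrix_k w k) => k.
have -> : (aug G - \matrix_k w k *m aug F) k 0 = aug G k 0 - (w k *m aug F) 0 0.
  rewrite !mxE; congr (_ - _); apply: eq_bigr => j _; by rewrite !mxE.
by rewrite /w; case: (constructive_indefinite_description _ _).
Qed.

Definition is_ideal I :=
  [/\ I 0, forall f g, I f -> I g -> I (f + g) & forall f g, I g -> I (f * g)].

Lemma is_ideal_sum I (T : Type) (s : seq T) (u : T -> R) :
  is_ideal I -> (forall t, I (u t)) -> I (\sum_(t <- s) u t).
Proof. by case=> I0 ID _ Iu; apply: big_ind. Qed.

Lemma is_idealN I f : is_ideal I -> I f -> I (- f).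
Proof. by case=> _ _ IM If; rewrite -mulN1r; apply: IM. Qed.

Lemma is_idealB I f g : is_ideal I -> I f -> I g -> I (f - g).
Proof. by move=> idI If Ig; case: (idI) => _ ID _; apply: ID => //; apply: is_idealN. Qed.

Lemma is_ideal_mulmx I (m n p : nat) (A : 'M[R]_(m, n)) (B : 'M[R]_(n, p)) :
  is_ideal I -> (forall i j, I (B i j)) -> forall i j, I ((A *m B) i j).
Proof.
move=> idI IB i j; rewrite mxE; apply: is_ideal_sum => // k.
by case: idI => _ _; apply.
Qed.

(** Comparison maps phi : F -> G and psi : G -> F compose to an endomorphism of F
    that lifts the identity. At the origin it is the identity matrix, and it
    factors through a space of dimension rk G i. *)
Lemma minimal_resolution_rk_le I F G :
  is_ideal I -> exact_seq I F -> minimal_seq F -> exact_seq I G ->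
  forall i, (rk F i <= rk G i)%N.
Proof.
move=> idI exF mF exG i; have [I0 _ _] := idI.
have lift H H' (exH : exact_seq I H) (exH' : exact_seq I H') :
    exists theta : forall i, 'M[R]_(rk H' i, rk H i), chain_map theta /\
      forall k, I ((aug H' - theta 0%N *m aug H) k 0).
  have [t0 It0] := aug_lift H' I0 exH.
  have [|theta [th0 chain]] := chain_lift (theta0 := t0) exH (exact_complex exH').
    move=> k; have -> : diff H' 0 *m t0 *m aug H =
        diff H' 0 *m aug H' - diff H' 0 *m (aug H' - t0 *m aug H).
      by rewrite mulmxBr opprB addrCA subrr addr0 mulmxA.
    rewrite mxE [X in _ + X]mxE; apply: is_idealB => //; first exact: exact_diff0.
    by apply: is_ideal_mulmx => // k' j; rewrite ord1.
  by exists theta; rewrite th0.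
have [phi [cphi phi0]] := lift _ _ exG exF.
have [psi [cpsi psi0]] := lift _ _ exF exG.
have comp : chain_map (fun i => phi i *m psi i).
  by move=> j; rewrite -mulmxA cpsi !mulmxA cphi.
apply: (mulmx1_min (A := (phi i)@0) (B := (psi i)@0)); rewrite -map_mxM.
apply: (chain_endo_eval0 exF mF comp) => k.
have -> : (phi 0%N *m psi 0%N - 1%:M) *m aug F =
    - (phi 0%N *m (aug G - psi 0%N *m aug F) + (aug F - phi 0%N *m aug G)).
  by rewrite mulmxBr mulmxBl mul1mx mulmxA opprD !opprB addrA subrK.
rewrite mxE; apply: is_idealN => //; rewrite mxE.
case: (idI) => _ ID _; apply: ID => //.
by apply: is_ideal_mulmx => // k' j; rewrite ord1.
Qed.

Lemma minimal_resolution_length I F p :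
  is_ideal I -> minimal_free_resolution I F -> has_length F p -> is_pd I p.
Proof.
move=> idI resF [Fp F0]; split; first by exists F.
case: (resF) => _ exF mF G [_ exG mG].
have rkE i : rk G i = rk F i.
  by apply/eqP; rewrite eqn_leq !(@minimal_resolution_rk_le I).
by split=> [|i pi]; rewrite rkE //; apply: F0.
Qed.

End Resolutions.

(** * Mapping cones *)

Section MappingCone.

Variables (K : fieldType) (r : nat).
Local Notation R := {mpoly K[r]}.
Implicit Types (I J C : R -> Prop) (F G : free_seq K r).

Definition homog_map F G (c : int) (theta : forall i, 'M[R]_(rk G i, rk F i)) :=
  forall i k j, homog_of_degree (shift k + c - shift j) (theta i k j).

Lemma chain_map_homog F G c (theta : forall i, 'M[R]_(rk G i, rk F i)) :
  graded_seq F -> graded_seq G -> chain_map theta ->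
  (forall k j, homog_of_degree (shift k + c - shift j) (theta 0%N k j)) ->
  exists theta' : forall i, 'M[R]_(rk G i, rk F i),
    [/\ theta' 0%N = theta 0%N, chain_map theta' & homog_map c theta'].
Proof.
move=> [_ gF] [_ gG] chain h0.
exists (fun i => \matrix_(k, j) hcomp (shift k + c - shift j) (theta i k j)).
split=> [|i|i k j]; last by rewrite mxE; apply: homog_hcomp.
  by apply/matrixP => k j; rewrite mxE hcomp_id.
apply/matrixP => k l; have /matrixP/(_ k l) := chain i; rewrite !mxE => eq_kl.
transitivity (hcomp (shift k + c - shift l) (\sum_j theta i.+1 k j * diff F i j l)).
  rewrite hcomp_sum; apply: eq_bigr => j _; rewrite mxE -(hcompM _ _ (gF i j l)).
  by congr hcomp; ring.
rewrite eq_kl hcomp_sum; apply: eq_bigr => j _.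
rewrite mxE mulrC [RHS]mulrC -(hcompM _ _ (gG i k j)).
by congr hcomp; ring.
Qed.

(** The cone of theta : G(-c) -> F is F_i (+) G_(i-1)(-c) in position i. The sum is
    spelled out by cases so that position 0 is F_0 itself. *)
Definition cone_rk F G i := if i is j.+1 then (rk F j.+1 + rk G j)%N else rk F 0.

Definition cone_shift F G (c : int) i : 'I_(cone_rk F G i) -> int :=
  match i return 'I_(cone_rk F G i) -> int with
  | 0 => fun k => shift k
  | j.+1 => fun k => match split k with inl a => shift a | inr b => shift b + c end
  end.

Definition cone_diff F G (theta : forall i, 'M[R]_(rk G i, rk F i)) i :
    'M[R]_(cone_rk F G i.+1, cone_rk F G i) :=
  match i return 'M[R]_(cone_rk F G i.+1, cone_rk F G i) with
  | 0 => col_mx (diff F 0) (theta 0%N)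
  (* Rows are mapped on the right, so the sign on G makes theta anticommute. *)
  | j.+1 => block_mx (diff F j.+1) 0 (theta j.+1) (- diff G j)
  end.

Definition cone F G c theta : free_seq K r :=
  @FreeSeq K r (cone_rk F G) (cone_shift c) (aug F) (@cone_diff F G theta).

Lemma cone_graded F G c (theta : forall i, 'M[R]_(rk G i, rk F i)) :
  graded_seq F -> graded_seq G -> homog_map c theta -> graded_seq (cone c theta).
Proof.
move=> [aF gF] [_ gG] ht; split=> [|[|i] k j] //=.
  by rewrite mxE /=; case: (split k) => a; [apply: gF | apply: ht].
rewrite mxE /=; case: (split k) => a; rewrite mxE; case: (split j) => b.
- exact: gF.
- by rewrite mxE; apply: homog0.
- exact: ht.
- rewrite mxE (_ : _ - _ = shift a - shift b); last by ring.
  exact/homogN/gG.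
Qed.

Lemma cone_minimal F G c (theta : forall i, 'M[R]_(rk G i, rk F i)) :
  minimal_seq F -> minimal_seq G ->
  (forall i k j, irrelevant_ideal (theta i k j)) -> minimal_seq (cone c theta).
Proof.
move=> mF mG mt [|i] k j /=.
  by rewrite mxE; case: (split k) => a; [apply: mF | apply: mt].
rewrite mxE; case: (split k) => a; rewrite mxE; case: (split j) => b.
- exact: mF.
- by rewrite mxE; apply: ideal_gen0.
- exact: mt.
- by rewrite mxE -mulN1r; apply/ideal_genMl/mG.
Qed.

Lemma cone_length F G c (theta : forall i, 'M[R]_(rk G i, rk F i)) p q :
  has_length F p -> has_length G q -> has_length (cone c theta) (maxn p q.+1).
Proof.
move=> [Fp F0] [Gq G0]; split=> /= [|i].
  have [pq|qp] := leqP p q.+1; first by rewrite addn_gt0 Gq orbT.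
  by case: p qp Fp {F0} => //= p _ Fp; rewrite addn_gt0 Fp.
rewrite gtn_max => /andP[pi qi]; case: i => // i in pi qi *.
by rewrite /= F0 // G0.
Qed.

(** With C = J : g and J' = J + (g), multiplication by g gives an exact sequence
    0 -> R/C -> R/J -> R/J' -> 0. Hence if theta lifts multiplication by g, its
    cone resolves R/J'. *)
Lemma cone_exact J C J' F G c (theta : forall i, 'M[R]_(rk G i, rk F i)) (g : R) :
  is_ideal J -> (forall f, C f <-> J (f * g)) ->
  (forall f, J' f <-> exists a b, J a /\ f = a + b * g) ->
  exact_seq J F -> exact_seq C G -> chain_map theta ->
  theta 0%N *m aug F = g *: aug G -> exact_seq J' (cone c theta).
Proof.
move=> idJ defC defJ' exF exG chain aug_theta.
have [surjF augF kerF] := exF; have [surjG augG kerG] := exG.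
have [J0 JD JM] := idJ.
have theta_aug n (u : 'M_(n, rk G 0)) k :
    (u *m theta 0%N *m aug F) k 0 = g * (u *m aug G) k 0.
  by rewrite -mulmxA aug_theta -scalemxAr mxE.
split=> [f|v|i v] /=.
- have [v Jv] := surjF f; exists v; apply/defJ'.
  by exists (f - (v *m aug F) 0 0), 0; rewrite mul0r addr0.
- split=> [/defJ'[a [b [Ja vE]]]|[w ->]].
    have [u /defC Cu] := surjG b.
    have [w defw] : exists w, v - u *m theta 0%N = w *m diff F 0.
      apply/augF; rewrite mulmxBl mxE [X in _ + X]mxE theta_aug vE.
      have -> : a + b * g - g * (u *m aug G) 0 0 = a + (b - (u *m aug G) 0 0) * g by ring.
      exact: JD.
    by exists (row_mx w u); rewrite mul_row_col -defw subrK.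
  rewrite -[w]hsubmxK mul_row_col mulmxDl mxE theta_aug; apply/defJ'.
  exists ((lsubmx w *m diff F 0 *m aug F) 0 0), ((rsubmx w *m aug G) 0 0).
  by split; [apply/augF; exists (lsubmx w) | rewrite [g * _]mulrC].
case: i v => [|i] v /=.
  split=> [|[w ->]]; last first.
    rewrite -[w]hsubmxK mul_row_block mulmx0 add0r mul_row_col mulmxDl -!mulmxA.
    rewrite (exact_complex exF) mulmx0 add0r chain mulNmx mulmxN.
    by rewrite subrr.
  rewrite -[v]hsubmxK mul_row_col; set v1 := lsubmx v; set v2 := rsubmx v => v0.
  have [w2 defw2] : exists w, v2 = w *m diff G 0.
    apply/augG/defC; rewrite mulrC -theta_aug; apply/augF; exists (- v1).
    by apply/eqP; rewrite mulNmx -subr_eq0 opprK addrC v0.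
  have [w1 defw1] : exists w, v1 + w2 *m theta 1%N = w *m diff F 1.
    apply/kerF; rewrite mulmxDl -mulmxA chain mulmxA -defw2; exact: v0.
  exists (row_mx w1 (- w2)); rewrite mul_row_block mulmx0 add0r -defw1.
  by rewrite !mulNmx mulmxN opprK addrK defw2.
split=> [|[w ->]]; last first.
  rewrite -[w]hsubmxK !mul_row_block !mulmx0 !add0r mulmxDl -!mulmxA.
  rewrite (exact_complex exF) mulmx0 add0r chain !mulNmx !mulmxN opprK.
  by rewrite subrr (exact_complex exG) mulmx0 row_mx0.
rewrite -[v]hsubmxK mul_row_block mulmx0 add0r.
set v1 := lsubmx v; set v2 := rsubmx v => /eqP; rewrite row_mx_eq0 => /andP[/eqP v0].
rewrite mulmxN oppr_eq0 => /eqP /kerG[w2 defw2].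
have [w1 defw1] : exists w, v1 + w2 *m theta i.+2 = w *m diff F i.+2.
  apply/kerF; rewrite mulmxDl -mulmxA chain mulmxA -defw2; exact: v0.
exists (row_mx w1 (- w2)); rewrite mul_row_block mulmx0 add0r -defw1.
by rewrite !mulNmx mulmxN opprK addrK defw2.
Qed.

(** The vector e splits the augmentation in degree 0. It provides an explicit
    homogeneous lift to F_0 of multiplication by a form, which starts the next
    cone, and it passes unchanged to the cone because F_0 does. *)
Definition resolvable J p :=
  exists (F : free_seq K r) (e : 'rV_(rk F 0)),
    [/\ minimal_free_resolution J F, has_length F p,
        forall k, homog_of_degree (- shift k) (e 0 k) & e *m aug F = 1%:M].

(** For g = h x, where C h is already contained in J, the lift of multiplication by
    g can be taken as x times a lift of multiplication by h. When x is in the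
    irrelevant ideal, this makes the cone minimal without any cancellation. *)
Lemma cone_resolvable J C J' (x h : R) dx dh p q :
  is_ideal J -> irrelevant_ideal x ->
  homog_of_degree dx x -> homog_of_degree dh h ->
  (forall f, C f -> J (f * h)) -> (forall f, J (f * (h * x)) -> C f) ->
  (forall f, J' f <-> exists a b, J a /\ f = a + b * (h * x)) ->
  resolvable J p -> resolvable C q -> resolvable J' (maxn p q.+1).
Proof.
move=> idJ irx hx hh CJ JC defJ' [F [e [[gF exF mF] lF he eE]]].
move=> [G [_ [[gG exG mG] lG _ _]]].
pose t0 : 'M[R]_(rk G 0, rk F 0) := h *: (aug G *m e).
have t0E : t0 *m aug F = h *: aug G by rewrite -scalemxAl -mulmxA eE mulmx1.
have [|t [t0' chain]] := chain_lift (theta0 := t0) exF (exact_complex exG).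
  move=> k; rewrite -mulmxA t0E -scalemxAr mxE mulrC; apply: CJ.
  exact: exact_diff0.
have [|theta [th0 thchain thhom]] := chain_map_homog (c := dh) gF gG chain.
  move=> k j; rewrite t0' mxE (_ : _ - _ = dh + (shift k - shift j)); last by ring.
  apply: homogM => //; rewrite mxE big_ord1; apply: homogM => //.
  by case: gG => + _; apply.
pose xtheta i := x *: theta i.
have xchain : chain_map xtheta by move=> i; rewrite -scalemxAl thchain scalemxAr.
exists (cone (dh + dx) xtheta), e; split=> //; last exact: cone_length.
split.
- apply: cone_graded => // i k j; rewrite mxE.
  rewrite (_ : _ - _ = dx + (shift k + dh - shift j)); last by ring.
  exact: homogM.
- apply: (@cone_exact J C _ _ _ _ _ (h * x)) => //.
    move=> f; split=> [/CJ Jf|]; last exact: JC.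
    by case: idJ => _ _ JM; rewrite mulrA mulrC; apply: JM.
  by rewrite -scalemxAl th0 t0' t0E scalerA mulrC.
- by apply: cone_minimal => // i k j; rewrite mxE; apply: ideal_genMr.
Qed.

Lemma resolvable0 J : (forall f, J f <-> f = 0) -> resolvable J 0.
Proof.
move=> defJ; pose rk0 i := (i == 0)%N : nat.
pose F := @FreeSeq K r rk0 (fun _ _ => 0) 1%:M (fun i => 0).
have Fi0 i (v : 'rV[R]_(rk F i.+1)) : v = 0 by apply/rowP => -[].
exists F, 1%:M; split; last by rewrite mulmx1.
- split; first split=> [k|i []] //.
  + by rewrite !ord1 mxE; apply: homog1.
  + split=> [f|v|i v].
    * by exists (const_mx f); apply/defJ; rewrite mulmx1 mxE subrr.
    * split=> [/defJ v0|[w ->]]; last by apply/defJ; rewrite mulmx0 mul0mx mxE.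
      by exists 0; rewrite mulmx0; apply/rowP => k; move: v0; rewrite mulmx1 !ord1 mxE.
    * by split=> _; [exists 0 | ]; apply/rowP; [move=> -[] | rewrite [v]Fi0 mul0mx].
  + by move=> i [].
- by split=> // -[].
- by move=> k; rewrite !ord1 mxE oppr0; apply: homog1.
Qed.

Lemma resolvable_is_pd J p : is_ideal J -> resolvable J p -> is_pd J p.
Proof. by move=> idJ [F [e [resF lF _ _]]]; apply: minimal_resolution_length resF lF. Qed.

Lemma resolvable_eq J J' p : (forall f, J f <-> J' f) -> resolvable J p -> resolvable J' p.
Proof.
move=> JJ' [F [e [[gF [ex0 ex1 ex2] mF] lF he eE]]]; exists F, e; split=> //; split=> //.
split=> // [f|v]; first by have [v /JJ'] := ex0 f; exists v.
by rewrite -JJ'.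
Qed.

End MappingCone.

(** * Monomial ideals *)

Section MonomialIdeals.

Variables (K : fieldType) (r : nat).
Local Notation R := {mpoly K[r]}.
Implicit Types (P : 'X_{1..r} -> Prop) (f : R) (m u : 'X_{1..r}).

(** For P closed under multiples, these are the elements of the monomial ideal
    spanned by the monomials in P. Membership is read off the support, which
    reduces colon ideals to conditions on exponents. *)
Definition monI P f := forall m, m \in msupp f -> P m.

Definition up_closed P := forall m u, P m -> P (m + u)%MM.

Lemma monI_ideal P : up_closed P -> is_ideal (monI P).
Proof.
move=> upP; split=> [m|f g Pf Pg m|f g Pg m]; first by rewrite msupp0.
  by move/msuppD_le; rewrite mem_cat => /orP[/Pf|/Pg].
move/msuppM_le/allpairsP => [[m1 m2] /= [_ /Pg Pm2 ->]].
by rewrite addmC; apply: upP.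
Qed.

Lemma monI_X P u : monI P 'X_[u] <-> P u.
Proof.
split=> [Pu|Pu m]; last by rewrite msuppX inE => /eqP ->.
by apply: Pu; rewrite msuppX inE.
Qed.

Lemma msuppMXP f u m :
  reflect (exists2 k, k \in msupp f & m = (k + u)%MM) (m \in msupp (f * 'X_[u])).
Proof.
rewrite (perm_mem (msuppMX _ _)).
by apply: (iffP mapP) => -[k kf ->]; exists k; rewrite // addmC.
Qed.

Lemma monI_MX P f u :
  monI P (f * 'X_[u]) <-> forall m, m \in msupp f -> P (m + u)%MM.
Proof.
rewrite /monI; split=> Pf m.
  by move=> mf; apply/Pf/msuppMXP; exists m.
by case/msuppMXP => k kf ->; apply: Pf.
Qed.

Lemma monI_adjoin P f u : up_closed P ->
  monI (fun m => P m \/ (u <= m)%MM) f <->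
  exists a b : R, monI P a /\ f = a + b * 'X_[u].
Proof.
move=> upP; have [I0 ID IM] := monI_ideal upP.
split=> [Pf|[a [b [Pa ->]]] m]; last first.
  move/msuppD_le; rewrite mem_cat => /orP[/Pa|]; first by left.
  by case/msuppMXP => k _ ->; right; apply: lem_addl.
rewrite (mpolyE f) big_seq.
apply: (big_ind (fun g => exists a b : R, monI P a /\ g = a + b * 'X_[u])) => [|g h|m /Pf[Pm|um]].
- by exists 0, 0; rewrite mul0r addr0.
- move=> [a [b [Pa ->]]] [a' [b' [Pa' ->]]]; exists (a + a'), (b + b').
  by split; [apply: ID | rewrite mulrDl addrACA].
- exists (f@_m *: 'X_[m]), 0; rewrite mul0r addr0; split=> //.
  by rewrite -mul_mpolyC; apply/IM/monI_X.
- exists 0, (f@_m *: 'X_[m - u]); split=> //.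
  by rewrite add0r -scalerAl -mpolyXD submK.
Qed.

Lemma ideal_gen_monI P (S : R -> Prop) f : up_closed P ->
  (forall g, S g -> exists u, P u /\ g = 'X_[u]) ->
  (forall m, P m -> exists u, (u <= m)%MM /\ S 'X_[u]) ->
  ideal_gen S f <-> monI P f.
Proof.
move=> upP SP PS; split=> [[n [c [g [Sg ->]]]]|Pf].
  apply: (is_ideal_sum (I := monI P)) => [|i]; first exact: monI_ideal.
  have [_ _ IM] := monI_ideal upP; apply: IM.
  by have [u [Pu ->]] := SP _ (Sg i); apply/monI_X.
rewrite (mpolyE f); apply: ideal_gen_sum => m /Pf/PS[u [um Su]].
rewrite -mul_mpolyC; apply: ideal_genMl.
by rewrite -(submK um) mpolyXD; apply/ideal_genMl/ideal_gen_base.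
Qed.

End MonomialIdeals.

(** * Path ideals: projective dimension and minimal generators *)

Section PathIdeals.

Variables (K : fieldType) (r : nat).
Local Notation R := {mpoly K[r]}.

(** The monomials divisible by an edge of the path on the first n vertices. All these
    shorter paths live in the same ring, so that their resolutions can be
    compared. *)
Definition edge_below n (m : 'X_{1..r}) :=
  exists i j : 'I_r, [/\ j = i.+1 :> nat, (j < n)%N, (0 < m i)%N & (0 < m j)%N].

Lemma edge_below_up n : up_closed (edge_below n).
Proof.
move=> m u [i [j [ij jn mi mj]]]; exists i, j; split=> //; rewrite mnmDE; lia.
Qed.

Lemma monX2 (i j : 'I_r) : 'X_i * 'X_j = 'X_[U_(i) + U_(j)] :> R.
Proof. by rewrite mpolyXD. Qed.

Lemma mnm1D_le (i j : 'I_r) (m : 'X_{1..r}) : i != j ->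
  (U_(i) + U_(j) <= m)%MM = (0 < m i)%N && (0 < m j)%N.
Proof.
move=> ij; apply/mnm_lepP/andP => [le|[mi mj] k].
  by have := le i; have := le j; rewrite !mnmDE !mnm1E !eqxx; lia.
rewrite mnmDE !mnm1E; case: (eqVneq i k) => [<-|ik].
  by rewrite eq_sym (negbTE ij) addn0.
by case: eqP => [<-|].
Qed.

Lemma edge_idealP (f : R) : edge_ideal (line_graph r) f <-> monI (edge_below r) f.
Proof.
apply: ideal_gen_monI => [|_ [i [j [/orP adj ->]]]|m [i [j [ij jr mi mj]]]].
- exact: edge_below_up.
- exists (U_(i) + U_(j))%MM; split; last exact: monX2.
  case: adj => /eqP ij; [exists i, j | exists j, i];
    by split=> //; rewrite mnmDE !mnm1E eqxx // addnC.
- exists (U_(i) + U_(j))%MM; split.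
    by rewrite mnm1D_le ?mi //; apply/eqP => /(congr1 val) /=; lia.
  by exists i, j; rewrite monX2 /= /line_adj -ij eqxx.
Qed.

Lemma edge_ideal_is_ideal : is_ideal (@edge_ideal K r (line_graph r)).
Proof.
split=> *; [exact: ideal_gen0 | exact: ideal_genD | exact: ideal_genMl].
Qed.

Lemma homogU (i : 'I_r) : homog_of_degree 1 ('X_i : R).
Proof. by have := @homogX K r U_(i); rewrite mdeg1. Qed.

(** Here x_k occurs in no edge of the short path, so it is a nonzerodivisor modulo
    its ideal J, and the cone of x_k : R/J -> R/J is one step longer. *)
Lemma resolvable_add_var n (k : 'I_r) p : (n <= k)%N ->
  resolvable (monI (K := K) (edge_below n)) p ->
  resolvable (monI (K := K) (fun m => edge_below n m \/ (0 < m k)%N)) p.+1.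
Proof.
move=> nk resJ; rewrite -(maxn_idPr (leqnSn p)).
apply: (cone_resolvable (C := monI (edge_below n)) (x := 'X_k) (h := 1) _ _ _ _ _ _ _ resJ resJ).
- exact/monI_ideal/edge_below_up.
- exact: irrelevant_var.
- exact: homogU.
- exact: homog1.
- by move=> f; rewrite mulr1.
- move=> f; rewrite mul1r => /monI_MX If m /If [i [j [ij jn mi mj]]].
  exists i, j; split=> //; [move: mi|move: mj];
    by rewrite mnmDE mnm1E (_ : k == _ = false) ?addn0 //; apply/eqP => /(congr1 val) /=; lia.
- move=> f; rewrite mul1r -monI_adjoin; last exact: edge_below_up.
  have eqP (m : 'X_{1..r}) : (0 < m k)%N = (U_(k) <= m)%MM.
    apply/idP/mnm_lepP => [mk i|/(_ k)]; last by rewrite mnm1E eqxx.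
    by rewrite mnm1E; case: eqP => [<-|].
  by split=> If m /If; rewrite eqP.
Qed.

(** Appending the leaf b to a path ending in a adjoins x_a x_b to its ideal J. Since
    x_b is a new variable, J : x_a x_b = J : x_a = C, and the cone lemma applies
    with x = x_b and h = x_a. *)
Lemma resolvable_step (a b : 'I_r) (C : 'X_{1..r} -> Prop) p q : b = a.+1 :> nat ->
  (forall m, C m <-> edge_below b (m + U_(a))%MM) ->
  resolvable (monI (K := K) (edge_below b)) p -> resolvable (monI (K := K) C) q ->
  resolvable (monI (K := K) (edge_below b.+1)) (maxn p q.+1).
Proof.
move=> ab defC.
apply: (cone_resolvable (x := 'X_b) (h := 'X_a)).
- exact/monI_ideal/edge_below_up.
- exact: irrelevant_var.
- exact: homogU.
- exact: homogU.
- by move=> f Cf; apply/monI_MX => m /Cf /defC.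
- move=> f; rewrite mulrA => /monI_MX If m mf; apply/defC.
  have /If[i [j [ij jb mi mj]]] : (m + U_(a))%MM \in msupp (f * 'X_a).
    by apply/msuppMXP; exists m.
  exists i, j; split=> //; [move: mi|move: mj];
    by rewrite mnmDE [X in (_ + X)%N]mnm1E (_ : b == _ = false) ?addn0 //;
       apply/eqP => /(congr1 val) /=; lia.
- move=> f; rewrite monX2 -monI_adjoin; last exact: edge_below_up.
  have ab' : a != b by apply/eqP => /(congr1 val) /=; lia.
  have eqP m : edge_below b.+1 m <-> edge_below b m \/ (U_(a) + U_(b) <= m)%MM.
    rewrite mnm1D_le //; split=> [[i [j [ij jb mi mj]]]|[|/andP[ma mb]]].
    + have [jb'|bj] := ltnP j b; first by left; exists i, j.
      right; rewrite (_ : a = i) 1?(_ : b = j) ?mi ?mj //; apply: val_inj => /=; lia.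
    + by case=> [i [j [ij jb mi mj]]]; exists i, j; split=> //; lia.
    + by exists a, b.
  by split=> If m /If; rewrite eqP.
Qed.

Lemma edge_below_small n m : (n <= 1)%N -> ~ edge_below n m.
Proof. by move=> n1 [i [j [ij jn _ _]]]; lia. Qed.

Lemma resolvable_small (P : 'X_{1..r} -> Prop) :
  (forall m, ~ P m) -> resolvable (monI (K := K) P) 0.
Proof.
move=> P0; apply: resolvable0 => f; split=> [Pf|-> m]; last by rewrite msupp0.
by apply: msuppnil0; rewrite /monI in Pf; case: (msupp f) Pf => // m s /(_ m (mem_head _ _)) /P0.
Qed.

(** Write I_n for the path ideal on the first n vertices. Removing the last vertex
    leaves I_(n-1), with colon ideal I_(n-3) + (x_(n-2)) in the numbering from 1.
    So the length l satisfies l(n) = max (l(n-1), l(n-3) + 2), whose solution is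
    n - ceil(n/3). *)
Lemma resolvable_path n : (n <= r)%N ->
  resolvable (monI (K := K) (edge_below n)) (n - (n + 2) %/ 3).
Proof.
elim/ltn_ind: n => n IHn nr.
have [n1|n2] := leqP n 1.
  rewrite (_ : _ - _ = 0)%N; last by lia.
  by apply: resolvable_small => m; apply: edge_below_small.
have bP : (n.-1 < r)%N by lia.
have aP : (n.-2 < r)%N by lia.
pose b := Ordinal bP; pose a := Ordinal aP.
have ab : b = a.+1 :> nat by rewrite /=; lia.
have nE : n = b.+1 by rewrite /=; lia.
have [n2'|n3] := leqP n 2.
  have -> : (n - (n + 2) %/ 3 = maxn (n.-1 - (n.-1 + 2) %/ 3) 1)%N by lia.
  rewrite [X in edge_below X]nE.
  apply: (@resolvable_step a b (fun=> False)) => //; last by apply: resolvable_small => m [].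
    by move=> m; split=> // /edge_below_small; apply; rewrite /=; lia.
  by apply: IHn; lia.
have cP : (n - 3 < r)%N by lia.
pose c := Ordinal cP.
have -> : (n - (n + 2) %/ 3 = maxn (n.-1 - (n.-1 + 2) %/ 3) (n - 3 - (n - 3 + 2) %/ 3).+2)%N by lia.
rewrite [X in edge_below X]nE.
apply: (@resolvable_step a b (fun m => edge_below (n - 3) m \/ (0 < m c)%N)) => //; last first.
- by apply: resolvable_add_var => //; apply: IHn; lia.
- by apply: IHn; lia.
move=> m; split=> [[[i [j [ij jn mi mj]]]|mc]|[i [j [ij jb mi mj]]]].
- by exists i, j; split=> //=; rewrite ?mnmDE; lia.
- by exists c, a; split=> //=; rewrite ?mnmDE ?mnm1E ?eqxx; lia.
have mi' : (0 < m i)%N.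
  by move: mi; rewrite mnmDE mnm1E (_ : a == i = false) ?addn0 //;
    apply/eqP => /(congr1 val) /=; move: jb => /=; lia.
have [jc|cj] := ltnP j (n - 3).
  left; exists i, j; split=> //; move: mj.
  by rewrite mnmDE mnm1E (_ : a == j = false) ?addn0 //; apply/eqP => /(congr1 val) /=; lia.
right; have [aj|aj] := eqVneq a j.
  by rewrite (_ : c = i) //; apply: val_inj => /=; have /= := congr1 val aj; lia.
rewrite (_ : c = j); first by move: mj; rewrite mnmDE mnm1E (negbTE aj) addn0.
by apply: val_inj => /=; move/eqP: aj => aj; have /= : (a <> j :> nat); [move/val_inj | move: jb => /=; lia].
Qed.

Lemma is_pd_path : is_pd (@edge_ideal K r (line_graph r)) (r - (r + 2) %/ 3).
Proof.
apply: resolvable_is_pd; first exact: edge_ideal_is_ideal.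
apply: (resolvable_eq (J := monI (edge_below r))); last exact: resolvable_path.
by move=> f; rewrite edge_idealP.
Qed.

(** The exponent of x_i x_(i+1), for a plain natural number i. *)
Definition edge_mnm i : 'X_{1..r} := [multinom ((k == i :> nat) || (k == i.+1 :> nat) : nat) | k < r].

Lemma edge_mnmE (i j : 'I_r) : j = i.+1 :> nat -> edge_mnm i = (U_(i) + U_(j))%MM.
Proof.
move=> ij; apply/mnmP => k; rewrite mnmE mnmDE !mnm1E -!val_eqE /=; lia.
Qed.

Lemma is_mu_path : is_mu (@edge_ideal K r (line_graph r)) r.-1.
Proof.
have IX m : edge_ideal (line_graph r) ('X_[m] : R) <-> edge_below r m.
  by rewrite edge_idealP monI_X.
exists [seq edge_mnm i | i <- iota 0 r.-1]; split.
- rewrite map_inj_in_uniq ?iota_uniq // => i j; rewrite !mem_iota => ir jr /mnmP eij.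
  have ip : (i < r)%N by lia.
  have jp : (j < r)%N by lia.
  have := eij (Ordinal ip); have := eij (Ordinal jp); rewrite !mnmE /=; lia.
- by rewrite size_map size_iota.
have edgeP (i j : 'I_r) : j = i.+1 :> nat -> edge_below r (edge_mnm i).
  by move=> ij; exists i, j; rewrite (edge_mnmE ij) !mnmDE !mnm1E !eqxx; split=> //; lia.
have edge_le (i j : 'I_r) m : j = i.+1 :> nat ->
    (edge_mnm i <= m)%MM = (0 < m i)%N && (0 < m j)%N.
  by move=> ij; rewrite (edge_mnmE ij) mnm1D_le //; apply/eqP => /(congr1 val) /=; lia.
move=> u; split=> [/mapP[i0 + ->]|[/IX[i [j [ij _ ui uj]]] umin]].
  rewrite mem_iota => ir.
  have ip : (i0 < r)%N by lia.
  have jp : (i0.+1 < r)%N by lia.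
  pose i := Ordinal ip; pose j := Ordinal jp.
  split=> [|v vi /IX[k [l [kl _ vk vl]]]]; first by apply/IX/(edgeP i j).
  have /mnm_lepP v_le := vi.
  have ki : i0 = k.
    by have := v_le k; have := v_le l; rewrite !mnmE; lia.
  have ik : i = k by apply: val_inj.
  have jl : j = l by apply: val_inj; rewrite /= ki.
  apply/mnmP => t; apply/eqP; rewrite eqn_leq v_le /=; move: t; apply/mnm_lepP.
  by rewrite (@edge_le i j) // ik jl vk vl.
apply/mapP; exists (i : nat); first by rewrite mem_iota; have := ltn_ord j; lia.
by apply/esym/umin; [rewrite (edge_le i j) ?ui | apply/IX/(edgeP i j)].
Qed.

End PathIdeals.

(** * Vertex degrees of the path *)

Section Rho.

Variable r : nat.

Lemma deg_path (v : 'I_r) : deg (line_graph r) v = ((0 < v) + (v.+1 < r))%N.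
Proof.
rewrite /deg; have [v0|v0] := posnP v; have [vr|rv] := ltnP v.+1 r.
- pose w := Ordinal vr; rewrite (_ : [set _ | _] = [set w]) ?cards1 //.
  by apply/setP => u; rewrite !inE /= /line_adj -val_eqE /=; lia.
- apply/eqP; rewrite cards_eq0; apply/eqP/setP => u; rewrite !inE /= /line_adj.
  by have := ltn_ord u; lia.
- have wr : (v.-1 < r)%N by lia.
  pose w := Ordinal wr; pose x := Ordinal vr.
  rewrite (_ : [set _ | _] = [set w; x]) ?cards2.
    by rewrite -val_eqE /=; lia.
  by apply/setP => u; rewrite !inE /= /line_adj -!val_eqE /=; lia.
- have wr : (v.-1 < r)%N by have := ltn_ord v; lia.
  pose w := Ordinal wr; rewrite (_ : [set _ | _] = [set w]) ?cards1 //.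
  by apply/setP => u; rewrite !inE /= /line_adj -val_eqE /=; have := ltn_ord u; lia.
Qed.

Lemma rho_path : (2 <= r)%N -> rho (line_graph r) = if (r <= 3)%N then 1%N else 2%N.
Proof.
move=> r2; apply/eqP; rewrite eqn_leq; apply/andP; split.
  apply/bigmax_leqP => -[i j] /=; rewrite /line_adj !deg_path => /orP ij.
  by have := ltn_ord i; have := ltn_ord j; case: ij => /eqP <-; case: ifP; lia.
pose a := if (r <= 3)%N then 0%N else 1%N.
have ap : (a < r)%N by rewrite /a; case: ifP; lia.
have bp : (a.+1 < r)%N by rewrite /a; case: ifP; lia.
apply: (@bigmax_sup _ (Ordinal ap, Ordinal bp)) => /=.
  by rewrite /line_adj /= eqxx.
rewrite !deg_path /= {ap bp}/a; case: ifP; rewrite leq_min; lia.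
Qed.

End Rho.

(** * A height bound for generators of a primary ideal *)

Section Span.

Variables (K : fieldType) (V : lmodType K) (T : finType) (w : T -> V).

Definition in_span (v : V) := exists c : T -> K, v = \sum_t c t *: w t.

Lemma in_span0 : in_span 0.
Proof. by exists (fun=> 0); rewrite big1 // => t _; rewrite scale0r. Qed.

Lemma in_spanD u v : in_span u -> in_span v -> in_span (u + v).
Proof.
case=> [c ->] [d ->]; exists (fun t => c t + d t); rewrite -big_split.
by apply: eq_bigr => t _; rewrite scalerDl.
Qed.

Lemma in_spanZ a v : in_span v -> in_span (a *: v).
Proof.
case=> [c ->]; exists (fun t => a * c t); rewrite scaler_sumr.
by apply: eq_bigr => t _; rewrite scalerA.
Qed.

Lemma in_span_base t : in_span (w t).
Proof.
exists (fun u => (u == t)%:R); rewrite (bigD1 t) //= eqxx scale1r big1 ?addr0 //.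
by move=> u /negbTE ->; rewrite scale0r.
Qed.

Lemma in_span_sum (I : Type) (s : seq I) (u : I -> V) :
  (forall i, in_span (u i)) -> in_span (\sum_(i <- s) u i).
Proof. by move=> su; apply: big_ind => //; [apply: in_span0 | apply: in_spanD]. Qed.

End Span.

Lemma ideal_gen_seqP (R : comNzRingType) (s : seq R) f :
  ideal_gen (fun g => g \in s) f ->
  exists q : 'I_(size s) -> R, f = \sum_j q j * s`_j.
Proof.
case=> n [c [g [gs ->]]].
apply: (big_ind (fun f => exists q : 'I_(size s) -> R, f = \sum_j q j * s`_j)).
- by exists (fun=> 0); rewrite big1 // => j _; rewrite mul0r.
- move=> _ _ [q ->] [q' ->]; exists (fun j => q j + q' j); rewrite -big_split.
  by apply: eq_bigr => j _; rewrite mulrDl.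
- move=> i _; have gi : (index (g i) s < size s)%N by rewrite index_mem.
  exists (fun j => if j == Ordinal gi then c i else 0).
  rewrite (bigD1 (Ordinal gi)) //= eqxx nth_index // big1 ?addr0 //.
  by move=> j /negbTE ->; rewrite mul0r.
Qed.

Section KrullHeight.

Variables (K : fieldType) (h : nat).
Local Notation R := {mpoly K[h]}.
Variable s : seq R.
Local Notation n := (size s).

Hypothesis s_irrelevant : forall g, g \in s -> g@_0 = 0.

(** The k-th power of the irrelevant ideal. *)
Definition order_ge k : R -> Prop := monI (fun m => (k <= mdeg m)%N).

Lemma order_ge_ideal k : is_ideal (order_ge k).
Proof. by apply: monI_ideal => m u; rewrite mdegD; lia. Qed.

Lemma order_geM k (f g : R) : order_ge k f -> g@_0 = 0 -> order_ge k.+1 (f * g).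
Proof.
move=> fk g0 m /msuppM_le/allpairsP[[m1 m2] /= [/fk km1 m2g ->]].
have : mdeg m2 != 0%N.
  by rewrite mdeg_eq0; apply: contraTneq m2g => ->; rewrite -mcoeff_eq0 g0.
by rewrite mdegD; lia.
Qed.

Definition box_mnm t (b : {ffun 'I_h -> 'I_t}) : 'X_{1..h} := [multinom (b i : nat) | i < h].

(** The products of a monomial with exponents below N and a monomial in the
    generators s with exponents below k. *)
Definition box_power N k (ba : {ffun 'I_h -> 'I_N} * {ffun 'I_n -> 'I_k}) : R :=
  'X_[box_mnm ba.1] * \prod_(j < n) s`_j ^+ ba.2 j.

(** A monomial outside the box is divisible by some x_i ^ N, which lies in the
    ideal of s. *)
Lemma span_box_modulo N (p : R) :
  (forall i, ideal_gen (fun g => g \in s) ('X_i ^+ N : R)) ->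
  exists (c : {ffun 'I_h -> 'I_N} -> K) (q : 'I_n -> R),
    p = \sum_b c b *: 'X_[box_mnm b] + \sum_j q j * s`_j.
Proof.
move=> XN.
suff [u [v [[c ->] /ideal_gen_seqP[q ->] ->]]] : exists u v : R,
    [/\ in_span (fun b : {ffun 'I_h -> 'I_N} => 'X_[box_mnm b] : R) u,
        ideal_gen (fun g => g \in s) v & p = u + v] by exists c, q.
rewrite (mpolyE p).
apply: (big_ind (fun p => exists u v : R,
    [/\ in_span (fun b : {ffun 'I_h -> 'I_N} => 'X_[box_mnm b] : R) u,
        ideal_gen (fun g => g \in s) v & p = u + v])).
- by exists 0, 0; split; [apply: in_span0 | apply: ideal_gen0 | rewrite addr0].
- move=> _ _ [u [v [su iv ->]]] [u' [v' [su' iv' ->]]]; exists (u + u'), (v + v').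
  by split; [apply: in_spanD | apply: ideal_genD | rewrite addrACA].
move=> m _; have [/forallP mN|] := boolP [forall i, (m i < N)%N].
  exists (p@_m *: 'X_[m]), 0; split; [|exact: ideal_gen0|by rewrite addr0].
  apply: in_spanZ; rewrite (_ : m = box_mnm [ffun i => Ordinal (mN i)]).
    exact: (in_span_base (fun b : {ffun 'I_h -> 'I_N} => 'X_[box_mnm b] : R)).
  by apply/mnmP => i; rewrite mnmE ffunE.
rewrite negb_forall => /existsP[i]; rewrite -leqNgt => Nm.
exists 0, (p@_m *: 'X_[m]); split; [exact: in_span0 | | by rewrite add0r].
have /submK <- : (U_(i) *+ N <= m)%MM.
  by apply/mnm_lepP => j; rewrite mulmnE mnm1E; case: eqP => [<-|]; rewrite ?mul1n.
by rewrite mpolyXD -mpolyXn -mul_mpolyC; apply/ideal_genMl/ideal_genMl.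
Qed.

(** Each substitution of the decomposition modulo (s) into the coefficients of
    the generators gains one order of vanishing and raises an exponent by one. *)
Lemma span_box_power N k (p : R) :
  (forall i, ideal_gen (fun g => g \in s) ('X_i ^+ N : R)) ->
  exists v, in_span (@box_power N k) v /\ order_ge k (p - v).
Proof.
move=> XN; elim: k p => [|k IHk] p.
  by exists 0; split=> //; apply: in_span0.
have [c [q ->]] := span_box_modulo p XN.
pose v j := sval (constructive_indefinite_description _ (IHk (q j))).
have vP j : in_span (@box_power N k) (v j) /\ order_ge k (q j - v j).
  by rewrite /v; case: (constructive_indefinite_description _ _).
exists (\sum_b c b *: 'X_[box_mnm b] + \sum_j v j * s`_j); split.
  apply: in_spanD; apply: in_span_sum.
    move=> b; apply: in_spanZ; have := in_span_base (@box_power N k.+1) (b, [ffun=> ord0]).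
    by rewrite /box_power /= big1 ?mulr1 // => j _; rewrite ffunE.
  move=> j; have [[d ->] _] := vP j; rewrite mulr_suml; apply: in_span_sum => -[b a].
  rewrite -scalerAl; apply: in_spanZ.
  have a1 (l : 'I_n) : (a l + (l == j) < k.+1)%N by have := ltn_ord (a l); lia.
  have := in_span_base (@box_power N k.+1) (b, [ffun l => Ordinal (a1 l)]).
  rewrite /box_power /= -mulrA; congr in_span; congr (_ * _).
  under eq_bigr do rewrite ffunE /= exprD.
  rewrite big_split /=; congr (_ * _); rewrite (bigD1 j) //= eqxx expr1 big1 ?mulr1 //.
  by move=> l /negbTE ->.
rewrite opprD addrACA subrr add0r -sumrB.
apply: (is_ideal_sum (I := order_ge k.+1)) => [|j]; first exact: order_ge_ideal.
by rewrite -mulrBl; apply: order_geM; [case: (vP j) | apply/s_irrelevant/mem_nth].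
Qed.

Lemma mdeg_box t (b : {ffun 'I_h -> 'I_t}) : (0 < h)%N -> (mdeg (box_mnm b) < h * t)%N.
Proof.
move=> h0; have t0 : (0 < t)%N by apply: leq_ltn_trans (ltn_ord (b (Ordinal h0))).
apply: (@leq_ltn_trans (h * t.-1)%N); last by rewrite ltn_pmul2l // prednK.
rewrite mdegE -[X in (X * _)%N]card_ord -sum_nat_const; apply: leq_sum => i _.
by rewrite mnmE; have := ltn_ord (b i); lia.
Qed.

Lemma box_mnm_inj t : injective (@box_mnm t).
Proof.
move=> b b' /mnmP bb'; apply/ffunP => i; apply: val_inj.
by have := bb' i; rewrite !mnmE.
Qed.

(** The t ^ h monomials with exponents below t have degree less than h t, so they stay
    linearly independent modulo the power h t of the irrelevant ideal. That
    quotient is spanned by N ^ h (h t) ^ n products. The two matrices below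
    express this as a factorization of the identity. *)
Lemma box_count N t : (0 < h)%N ->
  (forall i, ideal_gen (fun g => g \in s) ('X_i ^+ N : R)) ->
  (t ^ h <= N ^ h * (h * t) ^ n)%N.
Proof.
move=> h0 XN.
pose T : finType := {ffun 'I_h -> 'I_t}.
pose T' : finType := ({ffun 'I_h -> 'I_N} * {ffun 'I_n -> 'I_(h * t)})%type.
have cP (b : T) : exists c : T' -> K,
    order_ge (h * t) ('X_[box_mnm b] - \sum_x c x *: box_power x).
  by have [_ [[c ->] ord]] := span_box_power (h * t) 'X_[box_mnm b] XN; exists c.
pose c b := sval (constructive_indefinite_description _ (cP b)).
pose A := \matrix_(i < #|T|, j < #|T'|) c (enum_val i) (enum_val j).
pose B := \matrix_(j < #|T'|, i < #|T|) (box_power (enum_val j))@_(box_mnm (enum_val i)).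
have AB : A *m B = 1%:M.
  apply/matrixP => i i'; rewrite !mxE.
  have: order_ge (h * t) ('X_[box_mnm (enum_val i)] - \sum_x c (enum_val i) x *: box_power x).
    by rewrite /c; case: (constructive_indefinite_description _ _).
  move/(_ (box_mnm (enum_val i'))) => ord.
  have : ('X_[box_mnm (enum_val i)] - \sum_x c (enum_val i) x *: box_power x)
      @_(box_mnm (enum_val i')) == 0.
    by rewrite mcoeff_eq0; apply/negP => /ord; rewrite leqNgt mdeg_box.
  rewrite mcoeffB mcoeffX subr_eq0 (inj_eq (@box_mnm_inj t)) (inj_eq enum_val_inj).
  move/eqP ->; rewrite (raddf_sum (mcoeff _)) /= [RHS]big_enum_val.
  by apply: eq_bigr => j _; rewrite !mxE mcoeffZ.
have := mulmx1_min AB.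
by rewrite /T /T' card_prod !card_ffun !card_ord.
Qed.

(** Krull's height theorem for the irrelevant ideal, by counting dimensions: if n < h,
    the inequality t ^ h <= N ^ h (h t) ^ n fails for large t. *)
Lemma primary_to_irrelevant_size :
  (forall i, exists k, ideal_gen (fun g => g \in s) ('X_i ^+ k : R)) -> (h <= n)%N.
Proof.
move=> Xk; pose k i := sval (constructive_indefinite_description _ (Xk i)).
pose N := (\max_i k i)%N.
have XN i : ideal_gen (fun g => g \in s) ('X_i ^+ N : R).
  rewrite (_ : N = (N - k i) + k i)%N; last by rewrite subnK //; apply: leq_bigmax.
  rewrite exprD; apply: ideal_genMl.
  by rewrite /k; case: (constructive_indefinite_description _ _).
rewrite leqNgt; apply/negP => nh.
have h0 : (0 < h)%N by lia.
(* t exceeds the constant by which t ^ n is multiplied on the right. *)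
pose t := (N ^ h * h ^ n).+1.
have := box_count t h0 XN; apply/negP; rewrite -ltnNge expnMn mulnA.
apply: (@leq_trans (t * t ^ n)); first by rewrite ltn_pmul2r ?expn_gt0.
by rewrite -expnS leq_pexp2l.
Qed.

End KrullHeight.

(** * Lower bound for the arithmetical rank *)

Section AraLower.

Variables (K : fieldType) (r h : nat) (G : sgraph r) (c : 'I_h -> 'I_r).

Hypothesis c_inj : injective c.
Hypothesis cover : forall i j, adj G i j -> (i \in codom c) || (j \in codom c).
Hypothesis cover_min : forall j, exists2 i, adj G (c j) i & i \notin codom c.

(** The range of c is a minimal vertex cover, which corresponds to a minimal prime of
    height h. Setting the other variables to 1 plays the role of localizing at
    this prime: since each vertex of the cover has a neighbour outside, the edge
    ideal becomes the irrelevant ideal of the h remaining variables. *)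
Lemma minimal_cover_le_generators (s : seq {mpoly K[r]}) :
  generates_up_to_radical s (edge_ideal G) -> (h <= size s)%N.
Proof.
move=> gen.
pose lq : r.-tuple {mpoly K[h]} :=
  [tuple (if [pick j | c j == i] is Some j then 'X_j else 1) | i < r].
pose sigma := comp_mpoly lq : {rmorphism {mpoly K[r]} -> {mpoly K[h]}}.
have sigmaX i : sigma 'X_i = if [pick j | c j == i] is Some j then 'X_j else 1.
  by rewrite /sigma /= comp_mpolyXU -tnth_nth tnth_mktuple.
have sigma_in j : sigma 'X_(c j) = 'X_j.
  rewrite sigmaX; case: pickP => [k /eqP/c_inj -> //|/(_ j)]; by rewrite eqxx.
have sigma_out i : i \notin codom c -> sigma 'X_i = 1.
  rewrite sigmaX; case: pickP => // k /eqP <-; by rewrite codom_f.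
rewrite -(size_map sigma); apply: primary_to_irrelevant_size => [_ /mapP[g gs ->]|j].
  have [k [N [a [u [uI gk]]]]] : radical (edge_ideal G) g.
    by apply/gen; exists 1%N; rewrite expr1; apply: ideal_gen_base.
  suff : (sigma g)@_0 ^+ k = 0 by move/eqP; rewrite expf_eq0 => /andP[_ /eqP].
  rewrite -(rmorphXn (mcoeff 0%MM)) -(rmorphXn sigma) gk (rmorph_sum sigma).
  rewrite (raddf_sum (mcoeff 0%MM)) big1 //= => l _.
  have [i [j [ij ->]]] := uI l.
  have X0 i' : i' \in codom c -> (sigma 'X_i')@_0 = 0.
    by case/codomP => j' ->; rewrite sigma_in mcoeffX mnm1_eq0.
  rewrite !(rmorphM sigma) !(rmorphM (mcoeff 0%MM)) /=.
  by case/orP: (cover ij) => /X0 /= ->; rewrite ?mul0r ?mulr0.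
have [i ij inc] := cover_min j.
have [k [N [a [u [us def]]]]] : radical (ideal_gen (fun g => g \in s)) ('X_(c j) * 'X_i).
  by apply/gen; exists 1%N; rewrite expr1; apply: ideal_gen_base; exists (c j), i.
exists k, N, (sigma \o a), (sigma \o u); split=> [l|] /=; first exact: map_f.
have := congr1 sigma def; rewrite rmorphXn rmorphM sigma_in (sigma_out _ inc) mulr1 => ->.
by rewrite rmorph_sum; apply: eq_bigr => l _; rewrite rmorphM.
Qed.

End AraLower.

(** Numbering vertices from 0, take all i with i not 1 modulo 3, except the last
    vertex when r is 1 modulo 3. The complement is an independent set of
    ceil(r/3) vertices that dominates the path. *)
Lemma path_ara_lower (K : fieldType) r (s : seq {mpoly K[r]}) :
  generates_up_to_radical s (edge_ideal (line_graph r)) ->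
  (r - (r + 2) %/ 3 <= size s)%N.
Proof.
set h := (r - (r + 2) %/ 3)%N.
have cP (j : 'I_h) : (j + j.+1 %/ 2 < r)%N by have := ltn_ord j; rewrite /h; lia.
(* The sequence 0, 2, 3, 5, 6, 8, ... of numbers not congruent to 1 modulo 3. *)
pose c j := Ordinal (cP j).
have codomE (i : 'I_r) : i \in codom c = (i %% 3 != 1)%N && (i - i.+1 %/ 3 < h)%N.
  apply/codomP/andP => [[j ->] /=|[i3 ih]].
    by have := ltn_ord j; split; lia.
  by exists (Ordinal ih); apply: val_inj => /=; lia.
apply: (@minimal_cover_le_generators _ _ _ _ c).
- by move=> j k /(congr1 val) /= jk; apply: val_inj => /=; lia.
- move=> i j /= /orP ij; rewrite !codomE /h.
  by have := ltn_ord i; have := ltn_ord j; case: ij => /eqP; clear;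
     move: (nat_of_ord i) (nat_of_ord j) => {i j} i j; lia.
move=> j; have jh := ltn_ord j; rewrite /h in jh.
have jj : (2 * (j %/ 2) <= j)%N by lia.
(* c j is 3q or 3q + 2 with q = j / 2, and 3q + 1 is outside the cover. *)
have ip : (3 * (j %/ 2) + 1 < r)%N.
  by move: (j %/ 2)%N (nat_of_ord j) jh jj => a k; clear; lia.
have cj : (j + j.+1 %/ 2 = 3 * (j %/ 2) + 2 * (j %% 2))%N by lia.
exists (Ordinal ip); first by rewrite /= /line_adj /= cj; lia.
by rewrite codomE /= negb_and negbK; lia.
Qed.

(** * Upper bound for the arithmetical rank *)

Section Radicals.

Variable R : comNzRingType.
Implicit Types (S : R -> Prop) (f g : R).

Lemma radical_ideal_genD S f g :
  radical (ideal_gen S) f -> radical (ideal_gen S) g -> radical (ideal_gen S) (f + g).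
Proof.
move=> [k fk] [l gl]; exists (k + l)%N; rewrite exprDn; apply: ideal_gen_sum => i _.
rewrite -mulr_natl; apply: ideal_genMl; have [li|il] := leqP l i.
  by rewrite -(subnK li) exprD; apply/ideal_genMl/ideal_genMl.
rewrite (_ : k + l - i = (l - i) + k)%N; last by lia.
by rewrite exprD; apply/ideal_genMr/ideal_genMl.
Qed.

Lemma radical_ideal_genMl S f g :
  radical (ideal_gen S) g -> radical (ideal_gen S) (f * g).
Proof. by move=> [k gk]; exists k; rewrite exprMn; apply: ideal_genMl. Qed.

Lemma radical_ideal_gen_sub S S' :
  (forall g, S g -> radical (ideal_gen S') g) ->
  forall f, radical (ideal_gen S) f -> radical (ideal_gen S') f.
Proof.
move=> SS' f [k [n [c [u [uS fk]]]]].
suff [l fkl] : radical (ideal_gen S') (f ^+ k) by exists (k * l)%N; rewrite exprM.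
rewrite fk; apply: (big_ind (radical (ideal_gen S'))).
- by exists 1%N; rewrite expr1; apply: ideal_gen0.
- exact: radical_ideal_genD.
- by move=> i _; apply/radical_ideal_genMl/SS'.
Qed.

End Radicals.

(** On a path a - b - c - d, the product (a b)(c d) of the outer edges is a multiple of the
    middle edge b c. So b c and a b + c d generate all three edges up to radical. *)
Lemma square_outer_edge (R : comNzRingType) (a b c d : R) :
  (a * b) ^+ 2 = a * b * (a * b + c * d) - a * d * (b * c).
Proof. ring. Qed.

Section AraUpper.

Variables (K : fieldType) (r : nat).
Local Notation R := {mpoly K[r]}.

(** Variables indexed by all natural numbers, zero beyond the last one, so that the
    truncated final block of edges needs no separate treatment. *)
Definition var i : R := if insub i is Some k then 'X_k else 0.

Lemma varE (k : 'I_r) : var k = 'X_k.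
Proof. by rewrite /var valK. Qed.

Lemma var0 i : (r <= i)%N -> var i = 0.
Proof. by move=> ri; rewrite /var insubF // ltnNge ri. Qed.

(** The edges are grouped in blocks of three consecutive ones. *)
Definition path_radical_gens : seq R :=
  [seq var (3 * j) * var (3 * j + 1) + var (3 * j + 2) * var (3 * j + 3)
     | j <- iota 0 ((r + 1) %/ 3)] ++
  [seq var (3 * j + 1) * var (3 * j + 2) | j <- iota 0 (r %/ 3)].

Lemma size_path_radical_gens : size path_radical_gens = (r - (r + 2) %/ 3)%N.
Proof. by rewrite size_cat !size_map !size_iota; lia. Qed.

Lemma edge_ideal_var i : edge_ideal (line_graph r) (var i * var i.+1).
Proof.
have [ri|ir] := leqP r i.+1; first by rewrite (var0 ri) mulr0; apply: ideal_gen0.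
have ip : (i < r)%N by lia.
apply: ideal_gen_base; exists (Ordinal ip), (Ordinal ir); rewrite -!varE /=.
by rewrite /line_adj /= eqxx.
Qed.

Local Notation J := (ideal_gen (fun g => g \in path_radical_gens)).

Lemma middle_edge_in j : J (var (3 * j + 1) * var (3 * j + 2)).
Proof.
have [jr|rj] := ltnP j (r %/ 3).
  apply: ideal_gen_base; rewrite mem_cat orbC.
  by rewrite (map_f (fun j => var (3 * j + 1) * var (3 * j + 2))) // mem_iota.
by rewrite (@var0 (3 * j + 2)) ?mulr0; [apply: ideal_gen0 | lia].
Qed.

Lemma outer_edges_in j :
  J (var (3 * j) * var (3 * j + 1) + var (3 * j + 2) * var (3 * j + 3)).
Proof.
have [jr|rj] := ltnP j ((r + 1) %/ 3).
  apply: ideal_gen_base; rewrite mem_cat.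
  rewrite (map_f (fun j => var (3 * j) * var (3 * j + 1) +
                           var (3 * j + 2) * var (3 * j + 3))) //.
  by rewrite mem_iota.
rewrite (@var0 (3 * j + 1)) ?(@var0 (3 * j + 2)) ?mulr0 ?mul0r ?addr0; try lia.
exact: ideal_gen0.
Qed.

Lemma edge_in_radical i : radical J (var i * var i.+1).
Proof.
pose j := (i %/ 3)%N.
have [i0|i0] := eqVneq (i %% 3)%N 0%N.
  have -> : i = (3 * j)%N by rewrite /j; lia.
  exists 2%N; rewrite -[(3 * j).+1]addn1.
  rewrite (square_outer_edge _ _ (var (3 * j + 2)) (var (3 * j + 3))).
  by apply: ideal_genB; apply: ideal_genMl; [apply: outer_edges_in | apply: middle_edge_in].
have [i1|i1] := eqVneq (i %% 3)%N 1%N.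
  have -> : i = (3 * j + 1)%N by rewrite /j; lia.
  by exists 1%N; rewrite expr1 -addnS; apply: middle_edge_in.
have -> : i = (3 * j + 2)%N by rewrite /j; lia.
exists 2%N; rewrite -[(3 * j + 2).+1]addnS mulrC.
rewrite (square_outer_edge _ _ (var (3 * j + 1)) (var (3 * j))).
apply: ideal_genB; apply: ideal_genMl; last by rewrite mulrC; apply: middle_edge_in.
by rewrite addrC mulrC [X in _ + X]mulrC; apply: outer_edges_in.
Qed.

Lemma path_radical_gensP :
  generates_up_to_radical path_radical_gens (@edge_ideal K r (line_graph r)).
Proof.
move=> f; split; apply: radical_ideal_gen_sub => g; last first.
  case=> i [j [/orP adj ->]].
  by case: adj => /eqP ij; [|rewrite mulrC]; rewrite -!varE -ij; apply: edge_in_radical.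
have edge a b : b = a.+1 -> edge_ideal (line_graph r) (var a * var b).
  by move=> ->; apply: edge_ideal_var.
rewrite mem_cat => /orP[] /mapP[j _ ->]; exists 1%N; rewrite expr1.
  by apply: ideal_genD; apply: edge; lia.
by apply: edge; lia.
Qed.

End AraUpper.

Lemma is_ara_path (K : fieldType) r :
  is_ara (@edge_ideal K r (line_graph r)) (r - (r + 2) %/ 3).
Proof.
split; last exact: path_ara_lower.
by exists (path_radical_gens K r); [apply: size_path_radical_gens | apply: path_radical_gensP].
Qed.

(** * The invariants of the path *)

Unset Implicit Arguments.

Theorem mainTheorem4 (K : fieldType) (r : nat) (hr : (2 <= r)%N) :
  let I : {mpoly K[r]} -> Prop := @edge_ideal K r (line_graph r) in
  exists pd ara mu : nat,
    [/\ is_pd I pd, is_ara I ara & is_mu I mu] /\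
    [/\ pd = ara,
        forall s : nat, r = (3 * s)%N \/ r = (3 * s + 1)%N -> ara = (2 * s)%N,
        forall s : nat, r = (3 * s + 2)%N -> ara = (2 * s + 1)%N,
        ara%:Z = mu%:Z - (rho (line_graph r))%:Z + 1 <-> (2 <= r <= 6)%N
      & ~ (2 <= r <= 6)%N ->
        ara%:Z < mu%:Z - (rho (line_graph r))%:Z + 1].
Proof.
exists (r - (r + 2) %/ 3)%N, (r - (r + 2) %/ 3)%N, r.-1; split.
  by split; [apply: is_pd_path | apply: is_ara_path | apply: is_mu_path].
rewrite rho_path //; split=> [//|s|s||]; [lia | lia | |].
- by split; case: ifP; lia.
- by case: ifP; lia.
Qed.
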